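(* Let $f:\mathbb{R}_+\to\mathbb{R}_+$ be Baire (category case) or Lebesgue measurable (measure case), and suppose $f$ is weakly quasi regularly varying with essential limit function $g$, i.e. for every $t>0$ the essential limit $$\mathrm{ess}\text{-}\lim_{x\to\infty} f(tx)/f(x)=g(t)$$ exists and is finite (essential limits being taken modulo meagre sets in the category case and modulo Lebesgue-null sets in the measure case). Then $g$ is multiplicative: $g(st)=g(s)g(t)$ for all $s,t>0$. Furthermore, if $g$ is Baire (respectively, in the measure case, measurable), i.e. if $f$ is strongly quasi regularly varying, then for some $\gamma\in\mathbb{R}$, $g(t)=t^{\gamma}$ for all $t>0$.
   Context: $\mathbb{R}_+:=(0,\infty)$. A function is Baire if it has the Baire property (preimages of open sets have the Baire property). Essential limit: for a real-valued function $f$ and a real number $L$, $\mathrm{ess}\text{-}\lim_{x\to\infty}f(x)=L$ means that for each $\varepsilon>0$ there are $X_\varepsilon\in\mathbb{R}$ and a negligible set $M_\varepsilon$ such that $|f(x)-L|<\varepsilon$ for all $x>X_\varepsilon$ with $x\notin M_\varepsilon$. Negligible means meagre in the category case and Lebesgue-null in the measure case (the measure case is the category definition read in the density topology, in which meagre means null and having the Baire property means being Lebesgue measurable). A function $f:\mathbb{R}_+\to\mathbb{R}_+$ that is Baire (resp. measurable) is weakly quasi regularly varying if $g(t):=\mathrm{ess}\text{-}\lim_{x\to\infty}f(tx)/f(x)$ exists and is finite for each $t>0$, and strongly quasi regularly varying if in addition $g$ is Baire (resp. measurable). *)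

(* Defs.v *)
From mathcomp Require Import all_boot all_order all_algebra.
From mathcomp Require Import all_classical all_reals all_analysis.
From mathcomp Require Import measurable_realfun.

Set Implicit Arguments.
Unset Strict Implicit.
Unset Printing Implicit Defensive.

Import Order.TTheory GRing.Theory Num.Theory.
Import numFieldNormedType.Exports.

Local Open Scope classical_set_scope.
Local Open Scope ring_scope.

(* A function on R_+ := ]0, +oo[ is represented by a total function R -> R;
   no definition below depends on its values outside R_+, except [ess_lim],
   where the threshold X can always be enlarged to be positive. *)

Definition nowhere_dense (T : topologicalType) (A : set T) : Prop :=
  interior (closure A) = set0.

Definition meagre (T : topologicalType) (A : set T) : Prop :=
  exists F : nat -> set T,
    (forall n, nowhere_dense (F n)) /\ A `<=` \bigcup_n F n.

(* [A `+` U] is the symmetric difference. *)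
Definition baire_property (T : topologicalType) (A : set T) : Prop :=
  exists U : set T, open U /\ meagre (A `+` U).

(* When D is open, D `&` f @^-1` V has the Baire property in the whole space
   iff it has it relative to D. *)
Definition baire_fun (R : realType) (D : set R) (f : R -> R) : Prop :=
  forall V : set R, open V -> baire_property (D `&` f @^-1` V).

(* R with its Lebesgue sigma-algebra: the default structure [measurableTypeR]
   only has the Borel sets. *)
Definition lebesgueType (R : realType) :=
  g_sigma_algebraType (completed_algebra_gen (@lebesgue_measure R)).

Definition lebesgue_measurable_fun (R : realType) (D : set R) (f : R -> R) :
    Prop :=
  @measurable_fun _ _ (lebesgueType R) (measurableTypeR R) D f.

Variant setting := CategoryCase | MeasureCase.

Definition negligible_set (R : realType) (m : setting) (M : set R) : Prop :=
  match m with
  | CategoryCase => meagre M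
  | MeasureCase => (@lebesgue_measure R).-negligible M
  end.

(* Baire, resp. Lebesgue measurable, function on R_+ *)
Definition regular_fun (R : realType) (m : setting) (f : R -> R) : Prop :=
  match m with
  | CategoryCase => baire_fun `]0, +oo[ f
  | MeasureCase => lebesgue_measurable_fun `]0, +oo[ f
  end.

(* ess-lim_{x -> +oo} h x = L *)
Definition ess_lim (R : realType) (m : setting) (h : R -> R) (L : R) : Prop :=
  forall eps : R, 0 < eps ->
    exists (X : R) (M : set R), negligible_set m M /\
      forall x, X < x -> ~ M x -> `|h x - L| < eps.

(* f : R_+ -> R_+ is weakly quasi regularly varying, with essential limit
   function g : R_+ -> R *)
Definition weakly_qrv (R : realType) (m : setting) (f g : R -> R) : Prop :=
  [/\ forall x, 0 < x -> 0 < f x,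
      regular_fun m f &
      forall t, 0 < t -> ess_lim m (fun x => f (t * x) / f x) (g t)].

Definition strongly_qrv (R : realType) (m : setting) (f g : R -> R) : Prop :=
  weakly_qrv m f g /\ regular_fun m g.

(* Main.v *)
(* Negligible sets form a sigma-ideal that is invariant under dilations and
   contains no half-line, so essential limits at infinity are unique,
   multiplicative and invariant under x |-> t x.  Writing
   f(stx)/f(x) = f(s(tx))/f(tx) * f(tx)/f(x) gives g(st) = g(s) g(t), and
   g(1) = 1 then forces g > 0.

   If g is regular, some set A = {1/n < g < n} is not negligible, as these sets
   cover R_+.  By the multiplicative Steinhaus theorem (Piccard-Pettis in the
   category case, Lebesgue density in the measure case), every t near 1 is a
   quotient of two elements of A, hence ln g is bounded near 1.  So ln o g o exp
   is additive and bounded near 0, and therefore linear. *)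
Require Import Defs.
From HB Require Import structures.
From mathcomp Require Import all_boot all_order all_algebra.
From mathcomp Require Import all_classical all_reals all_analysis.
From mathcomp Require Import measurable_realfun lra ring.
Import Order.TTheory GRing.Theory Num.Theory.
Import numFieldNormedType.Exports.
Local Open Scope classical_set_scope.
Local Open Scope ring_scope.

Set Implicit Arguments.
Unset Strict Implicit.

(** * Meagre sets: countable unions, dilations, the Baire category theorem *)

Lemma meagreS (T : topologicalType) (A B : set T) :
  A `<=` B -> meagre B -> meagre A.
Proof. by move=> AB [F [ndF BF]]; exists F; split => // x /AB/BF. Qed.

Lemma meagre_bigcup (T : topologicalType) (A : nat -> set T) :
  (forall n, meagre (A n)) -> meagre (\bigcup_n A n).
Proof.
move=> /choice[F FA].
(* The double family is reindexed by codes of pairs; a number that codes no pair gets the empty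
   set. *)
exists (fun i => if unpickle i is Some nk then F nk.1 nk.2 else set0); split.
  move=> i; case: unpickle => [nk|]; first exact: (FA nk.1).1.
  by rewrite /nowhere_dense closure0 interior0.
move=> x [n _ Anx]; have [k _ Fx] := (FA n).2 _ Anx.
by exists (pickle (n, k)) => //; rewrite pickleK.
Qed.

(** The dilation by [t] is a homeomorphism with inverse the dilation by [t^-1], so it carries an
    interior point of the closure of the preimage to one of the closure of [A]. *)
Lemma nowhere_dense_scale (R : realType) (t : R) (A : set R) :
  t != 0 -> nowhere_dense A -> nowhere_dense (( *%R t) @^-1` A).
Proof.
move=> t0 ndA.
have ct (s : R) : continuous ( *%R s) by move=> x; exact: mulrl_continuous.
have clA : closure (( *%R t) @^-1` A) `<=` ( *%R t) @^-1` closure A.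
  rewrite [X in _ `<=` X](closure_id _).1; first last.
    by apply: closed_comp; [move=> ? _; exact: ct|exact: closed_closure].
  by apply: closureS => z; exact: (@subset_closure _ A).
apply: contrapT => /eqP/set0P[x xI].
suff : interior (closure A) (t * x) by rewrite ndA.
apply: (@filterS _ _ _
    (( *%R t^-1) @^-1` interior (closure (( *%R t) @^-1` A)))).
  by move=> y /interior_subset/clA; rewrite /= mulVKf.
apply: open_nbhs_nbhs; split; last by rewrite /= mulKf.
by apply: open_comp; [move=> ? _; exact: ct|exact: open_interior].
Qed.

Lemma meagre_scale (R : realType) (t : R) (A : set R) :
  t != 0 -> meagre A -> meagre (( *%R t) @^-1` A).
Proof.
move=> t0 [F [ndF AF]]; exists (fun n => ( *%R t) @^-1` F n); split.
  by move=> n; exact: nowhere_dense_scale.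
by move=> x /AF[n _ Fx]; exists n.
Qed.

(** Baire category theorem, applied to the complements of the closures of the [F n], which are open
    and dense. *)
Lemma meagre_open (R : realType) (A U : set R) :
  meagre A -> open U -> U !=set0 -> U `\` A !=set0.
Proof.
move=> [F [ndF AF]] oU U0.
have /Baire/(_ U U0 oU)[x [Ux xF]] :
    forall n, open (~` closure (F n)) /\ dense (~` closure (F n)).
  move=> n; split; first by rewrite openC; exact: closed_closure.
  move=> V [v Vv] oV; apply: contrapT => /set0P/negP/negPn/eqP VF.
  suff : interior (closure (F n)) v by rewrite ndF.
  apply: (@filterS _ _ _ V); last exact: open_nbhs_nbhs.
  by move=> y Vy; apply: contrapT => yF; have : set0 y by rewrite -VF.
exists x; split => // /AF[n _ Fnx]; apply: (xF n) => //.
exact: subset_closure.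
Qed.

(** * Lebesgue measure under dilations *)

Lemma measurable_preimage_scale (R : realType) (t : R)
    (A : set (measurableTypeR R)) :
  measurable A -> measurable (( *%R t) @^-1` A : set (measurableTypeR R)).
Proof.
have mt : measurable_fun setT
    ( *%R t : measurableTypeR R -> measurableTypeR R).
  exact: mulrl_measurable.
by move=> mA; rewrite -[X in measurable X]setTI; exact: mt.
Qed.

(** The set on the left is [t A]. Dividing its measure by [t] defines a measure in [A] that gives
    half-open intervals their length, so uniqueness of Lebesgue measure applies. *)
Lemma lebesgue_measure_scale (R : realType) (t : R) (A : set R) : 0 < t ->
  measurable A ->
  lebesgue_measure (( *%R t^-1) @^-1` A) = (t%:E * lebesgue_measure A)%E.
Proof.
move=> t0 mA.
have tV0 : 0 <= t^-1 by rewrite invr_ge0 ltW.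
suff <- : mscale (NngNum tV0) (pushforward lebesgue_measure
    ( *%R t^-1 : measurableTypeR R -> measurableTypeR R)) A =
    lebesgue_measure A.
  by rewrite /mscale /= muleA -EFinM divff ?gt_eqF// mul1e.
move=> mt; apply/esym/lebesgue_measure_unique => //= _ [[a b]] _ <-.
have preE : ( *%R t^-1) @^-1` `]a, b] = `](t * a), (t * b)]%classic.
  apply/seteqP; split => x /=; rewrite !in_itv /= -!(mulrC x);
   by rewrite ltr_pdivlMr// ler_pdivrMr// ![_ * t]mulrC.
rewrite /mscale/= /pushforward preE !lebesgue_measure_itv/= !lte_fin ltr_pM2l//.
case: ifPn => _; last by rewrite mule0.
by rewrite -!EFinB -EFinM -mulrBr mulKf ?gt_eqF.
Qed.


(** * Negligible sets, in both settings at once *)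

Lemma negligible_setS (R : realType) (m : setting) (A B : set R) :
  A `<=` B -> negligible_set m B -> negligible_set m A.
Proof.
case: m => /=; first exact: meagreS.
by move=> AB; apply: (@negligibleS _ _ _ lebesgue_measure).
Qed.

Lemma negligible_set_bigcup (R : realType) (m : setting) (A : nat -> set R) :
  (forall n, negligible_set m (A n)) -> negligible_set m (\bigcup_n A n).
Proof. by case: m => /=; [exact: meagre_bigcup|exact: negligible_bigcup]. Qed.

Lemma negligible_setU (R : realType) (m : setting) (A B : set R) :
  negligible_set m A -> negligible_set m B -> negligible_set m (A `|` B).
Proof.
move=> nA nB; rewrite -bigcup2E.
by apply: negligible_set_bigcup => -[|[|n]] //; apply: negligible_setS nA.
Qed.

Lemma negligible_set_scale (R : realType) (m : setting) (t : R) (A : set R) :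
  0 < t -> negligible_set m A -> negligible_set m (( *%R t) @^-1` A).
Proof.
move=> t0; case: m => /=; first by apply: meagre_scale; rewrite gt_eqF.
move=> [B [mB B0 AB]]; exists (( *%R t) @^-1` B); split.
- exact: measurable_preimage_scale.
- by rewrite -[t]invrK lebesgue_measure_scale ?invr_gt0// B0 mule0.
- by move=> x /AB.
Qed.

(** A half-line is open and nonempty in the category case, of infinite measure in the measure case.
    This supplies the points at which two essential limits are compared. *)
Lemma negligible_set_pinfty (R : realType) (m : setting) (X : R) (A : set R) :
  negligible_set m A -> exists x, X < x /\ ~ A x.
Proof.
case: m => /= [mA|[B [mB B0 AB]]].
  have [||x [/= Xx Ax]] := @meagre_open R A `]X, +oo[%classic mA.
  - exact: interval_open.
  - by exists (X + 1); rewrite /= in_itv/= andbT ltrDl.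
  - by exists x; move: Xx; rewrite in_itv/= andbT.
apply: contrapT => /forallNP nX.
have : (lebesgue_measure `]X, +oo[%classic <= lebesgue_measure B)%E.
  apply: le_measure; rewrite ?inE// => x; rewrite /= in_itv/= andbT => Xx.
  by apply: AB; apply: contrapT => Ax; exact: (nX x).
by rewrite B0 lebesgue_measure_itv/= ltry.
Qed.

(** * Essential limits at infinity *)

Lemma ess_lim_unique (R : realType) (m : setting) (h : R -> R) (a b : R) :
  ess_lim m h a -> ess_lim m h b -> a = b.
Proof.
move=> ha hb; apply/eqP/negPn/negP => ab.
have e0 : 0 < `|a - b| / 2 by rewrite divr_gt0// normr_gt0 subr_eq0.
have [X [M [nM hM]]] := ha _ e0; have [Y [N [nN hN]]] := hb _ e0.
have [x [xXY /not_orP[nMx nNx]]] :=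
  @negligible_set_pinfty R m (Num.max X Y) _ (negligible_setU nM nN).
move: xXY; rewrite gt_max => /andP[Xx Yx].
have := ltrD (hM _ Xx nMx) (hN _ Yx nNx).
rewrite -splitr ltNge (le_trans _ (ler_normB _ _))//=.
by rewrite [X in _ <= `|X|](_ : _ = b - a); [rewrite distrC|ring].
Qed.

Lemma ess_limM (R : realType) (m : setting) (h k : R -> R) (a b : R) :
  ess_lim m h a -> ess_lim m k b -> ess_lim m (h \* k) (a * b).
Proof.
move=> ha hb e e0.
have cM : (fun p : R * R => p.1 * p.2) p @[p --> (a, b)] --> a * b.
  exact: (@mul_continuous R (a, b)).
have /cM/nbhs_ballP[d /= d0 dM] : nbhs (a * b) (ball (a * b) e).
  exact: nbhsx_ballx.
have [X [M [nM hM]]] := ha _ d0; have [Y [N [nN hN]]] := hb _ d0.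
exists (Num.max X Y), (M `|` N); split; first exact: negligible_setU.
move=> x; rewrite gt_max => /andP[Xx Yx] /not_orP[nMx nNx].
have /dM/= : ball (a, b) d (h x, k x).
  by split; rewrite /ball/= distrC; [exact: hM|exact: hN].
by rewrite /ball/= distrC.
Qed.

Lemma ess_lim_scale (R : realType) (m : setting) (h : R -> R) (a t : R) :
  0 < t -> ess_lim m h a -> ess_lim m (fun x => h (t * x)) a.
Proof.
move=> t0 ha e e0; have [X [M [nM hM]]] := ha _ e0.
exists (X / t), (( *%R t) @^-1` M); split; first exact: negligible_set_scale.
by move=> x; rewrite ltr_pdivrMr// mulrC => Xx Mx; exact: hM.
Qed.

Lemma ess_lim_eq (R : realType) (m : setting) (h k : R -> R) (a : R) :
  (forall x, 0 < x -> h x = k x) -> ess_lim m h a -> ess_lim m k a.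
Proof.
move=> hk ha e e0; have [X [M [nM hM]]] := ha _ e0.
exists (Num.max X 0), M; split => // x.
by rewrite gt_max => /andP[Xx x0] Mx; rewrite -hk//; exact: hM.
Qed.

Lemma ess_lim_cst (R : realType) (m : setting) (a : R) :
  ess_lim m (cst a) a.
Proof.
move=> e e0; exists 0, set0; split; last by move=> *; rewrite subrr normr0.
case: m => /=; last exact: negligible_set0.
exists (fun=> set0); split=> // _.
by rewrite /nowhere_dense closure0 interior0.
Qed.

(** * Multiplicativity and positivity of the limit function *)

Lemma weakly_qrv_mult (R : realType) (m : setting) (f g : R -> R) :
  weakly_qrv m f g -> forall s t, 0 < s -> 0 < t -> g (s * t) = g s * g t.
Proof.
move=> [f0 _ fg] s t s0 t0.
apply: (ess_lim_unique (fg _ (mulr_gt0 s0 t0))).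
apply: ess_lim_eq (ess_limM (ess_lim_scale t0 (fg _ s0)) (fg _ t0)) => x x0 /=.
by rewrite [LHS]mulrA divfK ?mulrA// gt_eqF// f0// mulr_gt0.
Qed.

(** Since [g t * g t^-1 = g 1 = 1], [g] never vanishes; then [g t] is the square of the nonzero
    number [g (Num.sqrt t)]. *)
Lemma weakly_qrv_gt0 (R : realType) (m : setting) (f g : R -> R) :
  weakly_qrv m f g -> forall t, 0 < t -> 0 < g t.
Proof.
move=> fg; have gM := weakly_qrv_mult fg; case: fg => [f0 _ fg].
have g1 : g 1 = 1.
  apply: (ess_lim_unique (fg _ ltr01)); apply: ess_lim_eq (ess_lim_cst m 1).
  by move=> x x0; rewrite mul1r divff// gt_eqF// f0.
have gN0 t : 0 < t -> g t != 0.
  move=> t0; apply/eqP => gt0; have := gM t t^-1 t0.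
  rewrite invr_gt0 divff ?gt_eqF// g1 gt0 mul0r.
  by move=> /(_ t0)/eqP; rewrite oner_eq0.
move=> t t0; have st0 : 0 < Num.sqrt t by rewrite sqrtr_gt0.
rewrite -(sqr_sqrtr (ltW t0)) expr2 gM// -expr2.
by rewrite exprn_even_gt0//= gN0.
Qed.


(** * Multiplicative Steinhaus theorems *)

(** Modulo a meagre set [A] is an open [U], nonempty since [A] is not meagre. For [t] near 1 the
    open set of [y] with both [y] and [t * y] in [U] still contains a fixed [x] of [U], hence also a
    point avoiding both exceptional sets. *)
Lemma steinhaus_category (R : realType) (A : set R) :
  baire_property A -> ~ meagre A ->
  \forall t \near (1 : R), exists x, A x /\ A (t * x).
Proof.
move=> [U [oU AU]] nA.
have [x Ux] : U !=set0.
  apply: contrapT => /set0P/negP/negPn/eqP U0; apply: nA.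
  by apply: meagreS AU => y Ay; left; split => //; rewrite U0.
have Ut : \forall t \near (1 : R), U (t * x).
  have : (fun t : R => t * x) t @[t --> (1 : R)] --> 1 * x.
    exact: mulrr_continuous.
  by apply; rewrite mul1r; exact: open_nbhs_nbhs.
near=> t.
have t0 : t != 0 by rewrite gt_eqF//; near: t; exact: lt_nbhsr.
have [|||y [[Uy Uty] /not_orP[y1 y2]]] :=
    @meagre_open R ((A `+` U) `|` ( *%R t) @^-1` (A `+` U))
      (U `&` ( *%R t) @^-1` U).
- rewrite -bigcup2E; apply: meagre_bigcup => -[|[|n]] //=.
    exact: meagre_scale.
  exact: meagreS AU.
- apply: openI => //; apply: open_comp => // y _.
  exact: mulrl_continuous.
- by exists x; split => //; near: t.
exists y; split; apply: contrapT => nAy.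
- by apply: y1; right.
- by apply: y2; right.
Unshelve. all: by end_near. Qed.

(* If [E] and [t E] were disjoint, the ball of radius [5 r / 4], which contains
   both when [t] is close to [1], would be too small for their union. *)
Lemma steinhaus_ball (R : realType) (x r : R) (E : set R) :
  measurable E -> E `<=` ball x r -> 0 < r ->
  ((3 / 2 * r)%:E < lebesgue_measure E)%E ->
  \forall t \near (1 : R), exists y, E y /\ E (t * y).
Proof.
move=> mE Ex r0 muE.
near=> t.
(* Then [E] and [t E] have total measure above [(1 + 3 / 4) * (3 / 2 * r) = 21 / 8 * r], which
   exceeds the measure [5 / 2 * r] of the larger ball. *)
have t34 : 3 / 4 < t.
  by near: t; apply: lt_nbhsr; lra.
have t0 : 0 < t by lra.
(* This puts [t E] in the larger ball: for [z] in [E], [x - t * z = t * (x - z) - (t - 1) * x] is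
   less than [t * r + |(t - 1) * x|] in absolute value. *)
have tx : `|(t - 1) * x| + (t - 1) * r < r / 4.
  have t1 : `|1 - t| < r / (4 * (`|x| + r)).
    near: t; apply: nbhsx_ballx.
    by rewrite divr_gt0// mulr_gt0// ltr_wpDl.
  rewrite ltr_pdivlMr in t1; last by rewrite mulr_gt0// ltr_wpDl.
  rewrite normrM distrC.
  have : (t - 1) * r <= `|1 - t| * r.
    by rewrite ler_pM2r// distrC ler_norm.
  lra.
apply: contrapT => /forallNP nE.
pose E' := ( *%R t^-1) @^-1` E.
have mE' : measurable E' by exact: measurable_preimage_scale.
have EE' : E `&` E' = set0.
  apply/seteqP; split => // y [Ey E'y]; apply: (nE (t^-1 * y)).
  by rewrite mulVKf ?gt_eqF.
have : (lebesgue_measure (E `|` E') <= (5 / 2 * r)%:E)%E.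
  rewrite [leRHS](_ : _ = lebesgue_measure (ball x (5 / 4 * r))); last first.
    rewrite lebesgue_measure_ball; last lra.
    by congr EFin; rewrite -mulr_natr; lra.
  apply: le_measure; rewrite ?inE; [exact: measurableU|exact: measurable_ball|].
  move=> y [/Ex|/Ex]; rewrite /ball/= => xy.
    by rewrite (lt_trans xy)//; lra.
  have yE : y = t * (t^-1 * y) by rewrite mulVKf// gt_eqF.
  rewrite yE; move: (t^-1 * y) xy => z xz.
  have -> : x - t * z = t * (x - z) - (t - 1) * x by ring.
  rewrite (le_lt_trans (ler_normB _ _))// normrM (gtr0_norm t0).
  have : t * `|x - z| < t * r by rewrite ltr_pM2l.
  lra.
rewrite measureU//= lebesgue_measure_scale//.
rewrite leNgt => /negP; apply.
apply: (@lt_le_trans _ _ ((3 / 2 * r)%:E + t%:E * (3 / 2 * r)%:E)%E).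
  by rewrite -EFinM -EFinD lte_fin; nra.
apply: leeD; first exact: ltW.
by apply: lee_wpmul2l; [rewrite lee_fin ltW|exact: ltW].
Unshelve. all: by end_near. Qed.

(** Up to a null set [A] is a Borel set [B]; near a density point, [B] fills enough of a small ball
    for [steinhaus_ball]. *)
Lemma steinhaus_lebesgue (R : realType) (A : set R) :
  @measurable _ (lebesgueType R) A -> ~ lebesgue_measure.-negligible A ->
  \forall t \near (1 : R), exists x, A x /\ A (t * x).
Proof.
move=> mA nA.
have : completed_algebra_gen lebesgue_measure A.
  by rewrite -g_sigma_completed_algebra_genE.
move=> [B mB [N nN ABN]].
have BA : B `<=` A by rewrite -ABN; exact: subsetUl.
have [x Bx xd] : exists2 x, B x &
    (lebesgue_measure (B `&` ball x r) * (lebesgue_measure (ball x r))^-1)%E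
      @[r --> 0^'+] --> (\1_B x)%:E.
  (* Without a density point, [B] would lie in the exceptional null set of the density theorem, and
     [A] would be negligible. *)
  apply: contrapT => /forall2NP Bx; apply: nA.
  rewrite -ABN; apply: (@negligibleU _ _ _ lebesgue_measure) => //.
  apply: (@negligibleS _ _ _ lebesgue_measure) (lebesgue_density mB).
  by move=> x Bx0 /=; case: (Bx x).
rewrite indicE mem_set// in xd.
(* A ball of radius [r] has measure [2 * r], so density above [3 / 4] gives the bound [3 / 2 * r] of
   [steinhaus_ball]. *)
have /xd xr : nbhs (1%:E : \bar R) [set y | (3 / 4)%:E < y]%E.
  apply: open_nbhs_nbhs; split; first exact: open_ereal_gt_ereal.
  by rewrite /= lte_fin; lra.
have [r r0 /=] : exists2 r : R, 0 < r & ((3 / 4)%:E <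
    lebesgue_measure (B `&` ball x r) * (lebesgue_measure (ball x r))^-1)%E.
  near ((0 : R)^'+) => r; exists r; first by [].
  by near: r; exact: xr.
rewrite lebesgue_measure_ball ?ltW// inver mulrn_eq0/= gt_eqF//.
rewrite lte_pdivlMr ?mulrn_wgt0// -EFinM => xBr.
have mBr : measurable (B `&` ball x r).
  by apply: measurableI => //; exact: measurable_ball.
apply: filterS (steinhaus_ball mBr _ r0 _).
- by move=> t [y [[By _] [Bty _]]]; exists y; split; exact: BA.
- exact: subIsetr.
- by apply: le_lt_trans xBr; rewrite lee_fin -mulr_natr; lra.
Unshelve. all: by end_near. Qed.

(** * Additive functions bounded near 0 *)

(** Subtracting the linear function that agrees with [k] at [eta] leaves an additive [h] of period
    [eta], bounded on one period and so everywhere. A bounded additive function is zero. *)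
Lemma additive_bounded_linear (R : realType) (k : R -> R) (C : R) :
  {morph k : u v / u + v} -> (\forall u \near (0 : R), `|k u| <= C) ->
  exists c, forall u, k u = c * u.
Proof.
move=> kD /nbhs_ballP[d /= d0 kC].
pose eta := d / 2; have eta0 : 0 < eta by rewrite divr_gt0.
pose c := k eta / eta; exists c => u.
pose h u := k u - c * u.
have k0 : k 0 = 0 by apply: (addrI (k 0)); rewrite -kD !addr0.
have kN v : k (- v) = - k v by apply: (addrI (k v)); rewrite -kD !subrr.
have hB : zmod_morphism h by move=> v w; rewrite /h kD kN; ring.
pose H : {additive R -> R} := HB.pack h (GRing.isZmodMorphism.Build R R h hB).
have Heta : H eta = 0 by rewrite /= /h /c divfK ?gt_eqF// subrr.
(* A bound for [|h|] on [[0, eta[], an interval inside the ball where [|k| <= C]. *)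
pose C' := C + `|c| * eta.
have HC n : `|H u| *+ n <= C'.
  (* [h] vanishes on the multiples of [eta], so [n * h u = h r]. *)
  pose m := Num.floor (u *+ n / eta).
  pose r := u *+ n - eta *~ m.
  have r0 : 0 <= r.
    rewrite subr_ge0 -mulrzl -ler_pdivlMr//; exact: floor_le.
  have rd : r < eta.
    rewrite ltrBlDl -mulrzr -[X in _ + X]mulr1 -mulrDr mulrC -ltr_pdivrMr//.
    by have := floorD1_gt (u *+ n / eta); rewrite intrD.
  have -> : `|H u| *+ n = `|H r|.
    by rewrite /r raddfB raddfMn raddfMz Heta mul0rz subr0 normrMn.
  rewrite /= /h (le_trans (ler_normB _ _))// lerD//.
    apply: kC; rewrite /ball/= sub0r normrN ger0_norm//.
    by rewrite (lt_trans rd)// /eta; lra.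
  by rewrite normrM ler_wpM2l// ger0_norm// ltW.
suff /eqP : H u = 0 by rewrite subr_eq0 => /eqP.
apply/eqP; rewrite -normr_le0 leNgt; apply/negP => Hu0.
have := HC (Num.bound (C' / `|H u|)).
rewrite leNgt => /negP; apply; rewrite -mulr_natl -ltr_pdivrMr//.
apply: archi_boundP; rewrite divr_ge0//.
(* The case [n = 0] of [HC] reads [0 <= C']. *)
by have := HC 0%N.
Qed.

(** * From a non-negligible level set to the power law *)

Lemma regular_fun_steinhaus (R : realType) (m : setting) (g : R -> R)
    (V : set R) : regular_fun m g -> open V ->
  ~ negligible_set m (`]0, +oo[ `&` g @^-1` V) ->
  \forall t \near (1 : R), exists x, [/\ 0 < x, V (g x) & V (g (t * x))].
Proof.
move=> rg oV nV.
suff : \forall t \near (1 : R), exists x,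
    (`]0, +oo[ `&` g @^-1` V) x /\ (`]0, +oo[ `&` g @^-1` V) (t * x).
  apply: filterS => t [x [[x0 Vx] [_ Vtx]]]; exists x; split => //.
  by move: x0; rewrite /= in_itv/= andbT.
case: m rg nV => /= rg nV.
  by apply: steinhaus_category nV; exact: rg.
apply: steinhaus_lebesgue nV; apply: rg; last exact: open_measurable.
(* The half-line is Borel, hence in the completed algebra with empty null part. *)
apply: sub_sigma_algebra; exists `]0, +oo[%classic => //.
by exists set0; [exact: negligible_set0|rewrite setU0].
Qed.

Unset Implicit Arguments.
Set Strict Implicit.

Theorem theorem2 (R : realType) (m : setting) (f g : R -> R)
    (hf : weakly_qrv m f g) :
  (forall s t : R, 0 < s -> 0 < t -> g (s * t) = g s * g t) /\
  (strongly_qrv m f g ->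
     exists gamma : R, forall t : R, 0 < t -> g t = t `^ gamma).
Proof.
have gM := weakly_qrv_mult hf; have g0 := weakly_qrv_gt0 hf.
split=> // -[_ rg].
(* The endpoints are reciprocal, so that [g x] in [V n] bounds [ln (g x)] on both sides by
   [ln n.+1%:R]; the shift keeps the inverse meaningful at [n = 0]. *)
pose V (n : nat) : set R := `](n.+1%:R^-1), n.+1%:R[%classic.
have [n nV] : exists n, ~ negligible_set m (`]0, +oo[ `&` g @^-1` V n).
  apply/not_existsP => nV.
  have nU : negligible_set m (\bigcup_n (`]0, +oo[ `&` g @^-1` V n)).
    by apply: negligible_set_bigcup => n; apply: contrapT; exact: nV.
  have [x [x0]] := negligible_set_pinfty 0 nU; apply.
  pose n := Num.bound (Num.max (g x) (g x)^-1).
  have gx0 := g0 _ x0.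
  have : Num.max (g x) (g x)^-1 < n.+1%:R.
    rewrite (lt_trans (archi_boundP _))// ?ltr_nat//.
    by rewrite le_max ltW.
  rewrite gt_max => /andP[gn gVn].
  exists n => //; split => /=; first by rewrite in_itv/= x0.
  by rewrite /V /= in_itv/= gn andbT invf_plt// posrE.
have Vbound t : 0 < t -> V n (g t) -> `|ln (g t)| <= ln n.+1%:R.
  move=> t0; have gt0 := g0 _ t0.
  rewrite /V /= in_itv/= => /andP[ngt gtn].
  rewrite ler_norml -lnV ?posrE// !ler_ln ?posrE// ?invr_gt0//.
  by rewrite !ltW.
(* The bound appears twice because [ln (g (expR u))] is the difference of [ln (g (expR u * x))] and
   [ln (g x)], with both values of [g] in [V n]. *)
have [||c gE] := @additive_bounded_linear R (fun u => ln (g (expR u)))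
    (ln n.+1%:R + ln n.+1%:R).
- by move=> u v /=; rewrite expRD gM ?expR_gt0// lnM// posrE g0// expR_gt0.
- have exp1 : expR u @[u --> (0 : R)] --> (1 : R).
    by rewrite -expR0; exact: continuous_expR.
  have oV : open (V n) by exact: interval_open.
  have := exp1 _ (regular_fun_steinhaus rg oV nV).
  apply: (@filterS _ (nbhs (0 : R))) => u [x [x0 Vx Vux]].
  have eu0 := expR_gt0 u.
  have eux0 : 0 < expR u * x by rewrite mulr_gt0.
  have -> : ln (g (expR u)) = ln (g (expR u * x)) - ln (g x).
    by rewrite gM// lnM ?posrE ?g0// addrK.
  by rewrite (le_trans (ler_normB _ _))// lerD// Vbound.
(* Linearity is used at [u = ln t], where [t] to the power [c] is [expR (c * ln t)]. *)
exists c => t t0; rewrite /powR gt_eqF// -gE lnK ?posrE// lnK ?posrE//.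
exact: g0.
Qed.
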